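(* Let $X\subseteq\mathbb{R}^n$ and $Y\subseteq\mathbb{R}^m$ be nonempty, closed and convex sets, let $f:\mathbb{R}^n\times\mathbb{R}^m\to\mathbb{R}$ be locally Lipschitz continuous, and assume that $\varphi(x):=\max_{y\in Y}f(x,y)$ is finite-valued for every $x\in X$. Consider the problem $\min_{x\in X}\max_{y\in Y}f(x,y)$. (i) If $\Phi_u:=\{x\in X:\varphi(x)\le u\}$ is nonempty and bounded for some scalar $u$, and $\{y\in Y:f(x,y)\ge l_x\}$ is bounded for every $x\in\Phi_u$ and some scalar $l_x$, then the problem has at least one global minimax point. (ii) A point $(x^*,y^* )\in X\times Y$ is a local minimax point of the problem if and only if $y^*$ is a local maximizer of $f(x^*,\cdot)$ (over $Y$) and there exists a $\delta_0>0$ such that $x^*$ is a local minimizer (over $X$) of $\varphi_\delta(x):=\max_{y'\in\{y\in Y:\|y-y^*\|\le\delta\}}f(x,y')$ for any $\delta\in(0,\delta_0]$.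
   Context: $\|\cdot\|$ is the Euclidean norm. A point $(\hat x,\hat y)\in X\times Y$ is a global minimax point of $\min_{x\in X}\max_{y\in Y}f(x,y)$ if $$f(\hat x,y)\le f(\hat x,\hat y)\le\max_{y'\in Y}f(x,y')$$ holds for any $(x,y)\in X\times Y$. A point $(\hat x,\hat y)\in X\times Y$ is a local minimax point of this problem if there exist a $\delta_0>0$ and a function $\tau:\mathbb{R}_+\to\mathbb{R}_+$ satisfying $\tau(\delta)\to0$ as $\delta\to0$, such that for any $\delta\in(0,\delta_0]$ and any $(x,y)\in X\times Y$ satisfying $\|x-\hat x\|\le\delta$ and $\|y-\hat y\|\le\delta$, $$f(\hat x,y)\le f(\hat x,\hat y)\le\max_{y'\in\{y\in Y:\|y-\hat y\|\le\tau(\delta)\}}f(x,y').$$ The function $\tau$ is always assumed to be monotone and continuous, which does not change this notion. *)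

(* Defs.v *)
From HB Require Import structures.
From mathcomp Require Import all_boot all_order all_algebra.
From mathcomp Require Import all_classical all_reals all_analysis.

Set Implicit Arguments.
Unset Strict Implicit.
Unset Printing Implicit Defensive.

Import Order.TTheory GRing.Theory Num.Theory.
Import numFieldNormedType.Exports.

Local Open Scope classical_set_scope.
Local Open Scope ring_scope.

(* The library norm `|v| on 'rV[R]_n is the sup norm, hence a separate
   Euclidean norm. *)
Definition enorm (R : realType) (n : nat) (v : 'rV[R]_n) : R :=
  Num.sqrt (\sum_(i < n) v 0 i ^+ 2).

Definition eball (R : realType) (n : nat) (A : set 'rV[R]_n) (a : 'rV[R]_n)
    (r : R) : set 'rV[R]_n :=
  [set x | A x /\ enorm (x - a) <= r].

(* Neighbourhoods and the Lipschitz property are those of the library sup norm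
   on the product; all norms being equivalent, only the unspecified local
   constants depend on this. *)
Definition locally_lipschitz (R : realType) (n m : nat)
    (f : 'rV[R]_n * 'rV[R]_m -> R) : Prop :=
  forall p : 'rV[R]_n * 'rV[R]_m, exists2 U, nbhs p U & [lipschitz f z | z in U].

(* max_{y in D} f (x, y), with value in the extended reals. It is the supremum,
   which is the maximum whenever that is attained, in particular when f is
   continuous and D is nonempty and compact. *)
Definition maxval (R : realType) (n m : nat) (f : 'rV[R]_n * 'rV[R]_m -> R)
    (D : set 'rV[R]_m) (x : 'rV[R]_n) : \bar R :=
  ereal_sup [set (f (x, y))%:E | y in D].

Definition max_attained (R : realType) (n m : nat)
    (f : 'rV[R]_n * 'rV[R]_m -> R) (D : set 'rV[R]_m) (x : 'rV[R]_n) : Prop :=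
  exists2 y, D y & forall y', D y' -> f (x, y') <= f (x, y).

Definition global_minimax (R : realType) (n m : nat) (X : set 'rV[R]_n)
    (Y : set 'rV[R]_m) (f : 'rV[R]_n * 'rV[R]_m -> R)
    (xh : 'rV[R]_n) (yh : 'rV[R]_m) : Prop :=
  [/\ X xh, Y yh &
    forall x y, X x -> Y y ->
      f (xh, y) <= f (xh, yh) /\ ((f (xh, yh))%:E <= maxval f Y x)%E].

(* A function from [0, +oo[ to [0, +oo[, given as a function on R of which only
   the restriction to [0, +oo[ matters. A monotone one is taken nondecreasing:
   a nonincreasing continuous one with limit 0 at 0 vanishes identically. *)
Definition radius_function (R : realType) (tau : R -> R) : Prop :=
  [/\ forall d, 0 <= d -> 0 <= tau d,
      forall d1 d2, 0 <= d1 -> d1 <= d2 -> tau d1 <= tau d2,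
      {within `[0, +oo[, continuous tau} &
      tau d @[d --> 0^'+] --> 0].

Definition local_minimax (R : realType) (n m : nat) (X : set 'rV[R]_n)
    (Y : set 'rV[R]_m) (f : 'rV[R]_n * 'rV[R]_m -> R)
    (xh : 'rV[R]_n) (yh : 'rV[R]_m) : Prop :=
  [/\ X xh, Y yh &
    exists delta0 : R, exists tau : R -> R,
      [/\ 0 < delta0, radius_function tau &
        forall delta, 0 < delta -> delta <= delta0 ->
        forall x y, eball X xh delta x -> eball Y yh delta y ->
          f (xh, y) <= f (xh, yh) /\
          ((f (xh, yh))%:E <= maxval f (eball Y yh (tau delta)) x)%E]].

Definition local_minimizer (R : realType) (n : nat) (A : set 'rV[R]_n)
    (g : 'rV[R]_n -> \bar R) (a : 'rV[R]_n) : Prop :=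
  A a /\ exists2 r : R, 0 < r & forall x, eball A a r x -> (g a <= g x)%E.

Definition local_maximizer (R : realType) (n : nat) (A : set 'rV[R]_n)
    (g : 'rV[R]_n -> R) (a : 'rV[R]_n) : Prop :=
  A a /\ exists2 r : R, 0 < r & forall x, eball A a r x -> g x <= g a.

(* Main.v *)
Require Import Defs.
From mathcomp Require Import all_boot all_order all_algebra.
From mathcomp Require Import all_classical all_reals all_analysis.
From mathcomp Require Import lra.

Import Order.TTheory GRing.Theory Num.Theory.
Import numFieldNormedType.Exports.

Local Open Scope classical_set_scope.
Local Open Scope ring_scope.

(** Global part. The function [phi = maxval f Y] is a supremum of continuous
    functions, so its sublevel sets are closed, and the bounded one [Phi u] is
    compact. A function with closed sublevel sets attains its minimum on a compact set
    ([compact_closed_sublevel_min]); a minimizer of [phi] over [Phi u] is one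
    over [X], because [phi > u] on the rest of [X]. Paired with a maximizer of
    [f (xh, .)] over [Y] it is a global minimax point
    ([global_minimax_of_attained]). When such a maximizer is not given, it
    comes from a nonempty compact level set ([max_attained_level]).

    Local part. On a ball of radius [delta] where [ys] maximizes [f (xs, .)],
    the number [f (xs, ys)] is the value of [phi_delta] at [xs]. A local
    minimax point thus compares [phi_delta] at [xs] with [phi_(tau r)] at
    nearby points, and [phi_(tau r) <= phi_delta] as soon as [tau r <= delta].
    Conversely, each level [s] comes with a radius [rho s] on which [xs]
    minimizes [phi_s], but [rho] is arbitrary; the work is to invert it into
    one nondecreasing continuous function [tau] tending to 0. Since enlarging
    [tau] only weakens the minimax inequality, it is enough that [tau d] be
    at least some [s] with [d <= rho s]; a concave envelope does this without
    any discussion of jumps ([radius_function_envelope]). *)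

(** * Minimizing over a compact set *)

(** Continuity is replaced by closedness of the sublevel sets, which is what a
    supremum of continuous functions has. Each value of [phi] on [A] gives a
    sublevel set, and these sets form a chain of nonempty sets; a cluster
    point of the filter they generate lies in all of them. *)
Lemma compact_closed_sublevel_min (d : Order.disp_t) (V : orderType d)
    (T : topologicalType) (phi : T -> V) (A : set T) :
  A !=set0 -> compact A ->
  (forall c, closed [set x | A x /\ (phi x <= c)%O]) ->
  exists2 x, A x & forall z, A z -> (phi x <= phi z)%O.
Proof.
move=> [a Aa] cA clS.
pose S z := [set x | A x /\ (phi x <= phi z)%O].
have FS : ProperFilter (filter_from A S).
  apply: filter_from_proper; last by move=> z Az; exists z.
  apply: filter_from_filter; first by exists a.
  move=> i j Ai Aj; have [ij|/ltW ji] := leP (phi i) (phi j).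
    by exists i => // x [Ax xi]; split; split => //; exact: le_trans xi ij.
  by exists j => // x [Ax xj]; split; split => //; exact: le_trans xj ji.
have [|x [Ax clx]] := cA (filter_from A S) FS; first by exists a => // x [].
exists x => // z Az.
suff [] : S z x by [].
by apply: clS => B Bx; apply: clx => //; exists z.
Qed.

(** * Continuity and attainment of the maxima *)

Lemma locally_lipschitz_continuous (R : realType) (n m : nat)
    (f : 'rV[R]_n * 'rV[R]_m -> R) : locally_lipschitz f -> continuous f.
Proof.
move=> flip p; have [U Up lipU] := flip p.
near +oo_R => M.
have M0 : 0 < M by near: M; exact: nbhs_pinfty_gt.
have lipM : M.-lipschitz_U f by near: M.
apply/cvgrPdist_lt => e e0; near=> q.
have Uq : U q by near: q.
have /= le_pq := lipM (p, q) (conj (nbhs_singleton Up) Uq).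
apply: le_lt_trans le_pq _.
rewrite mulrC -ltr_pdivlMr //.
by near: q; apply: cvgr_dist_lt; rewrite ?divr_gt0.
Unshelve. all: by end_near.
Qed.

Lemma maxval_attained {R : realType} {n m : nat}
    {f : 'rV[R]_n * 'rV[R]_m -> R} {D : set 'rV[R]_m} {x : 'rV[R]_n}
    {y : 'rV[R]_m} :
  D y -> (forall y', D y' -> f (x, y') <= f (x, y)) ->
  maxval f D x = (f (x, y))%:E.
Proof.
move=> Dy ymax; apply/eqP; rewrite eq_le; apply/andP; split.
  by apply: ge_ereal_sup => _ [y' Dy' <-]; rewrite lee_fin; exact: ymax.
by apply: ereal_sup_ubound; exists y.
Qed.

Lemma le_maxval (R : realType) (n m : nat) (f : 'rV[R]_n * 'rV[R]_m -> R)
    (D E : set 'rV[R]_m) (x : 'rV[R]_n) :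
  D `<=` E -> (maxval f D x <= maxval f E x)%E.
Proof. by move=> DE; apply: le_ereal_sup; exact: image_subset. Qed.

Lemma closed_sublevel_maxval (R : realType) (n m : nat)
    (f : 'rV[R]_n * 'rV[R]_m -> R) (D : set 'rV[R]_m) (X : set 'rV[R]_n)
    (c : \bar R) :
  continuous f -> closed X -> closed [set x | X x /\ (maxval f D x <= c)%E].
Proof.
move=> cf clX.
have -> : [set x | X x /\ (maxval f D x <= c)%E] =
    X `&` \bigcap_(y in D) [set x | ((f (x, y))%:E <= c)%E].
  apply/seteqP; split => x [Xx /=].
    move=> le_c; split => // y Dy /=; apply: le_trans le_c.
    by apply: ereal_sup_ubound; exists y.
  move=> le_c; split => //; apply: ge_ereal_sup => _ [y Dy <-]; exact: le_c.
apply: closedI => //; apply: closed_bigI => y Dy.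
case: c => [c| |].
- apply: (@preimage_closed _ _ (fun x => f (x, y)) [set t | (t%:E <= c%:E)%E]).
    move=> x _.
    apply: (@continuous_comp _ _ _ (fun z => (z, y)) f); last exact: cf.
    apply: (@cvg_pair _ _ _ (nbhs x) (nbhs x) (nbhs y)).
      exact: cvg_id.
    exact: cvg_cst.
  by under eq_set do rewrite lee_fin; exact: closed_le.
- rewrite (_ : [set x | _] = setT); first exact: closedT.
  by apply/seteqP; split => // x _; exact: leey.
- rewrite (_ : [set x | _] = set0); first exact: closed0.
  by apply/seteqP; split => // x.
Qed.

(** The supremum over [Y] is already decided on the nonempty compact level set
    [f (x, .) >= l]. *)
Lemma max_attained_level (R : realType) (n m : nat)
    (f : 'rV[R]_n * 'rV[R]_m -> R) (Y : set 'rV[R]_m) (x : 'rV[R]_n) (l : R) :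
  continuous f -> closed Y -> [set y | Y y /\ l <= f (x, y)] !=set0 ->
  bounded_set [set y | Y y /\ l <= f (x, y)] -> max_attained f Y x.
Proof.
set L := [set y | _] => cf clY L0 bL.
have cfx : continuous (fun y => f (x, y)).
  move=> y; apply: (@continuous_comp _ _ _ (fun z => (x, z)) f); last exact: cf.
  apply: (@cvg_pair _ _ _ (nbhs y) (nbhs x) (nbhs y)).
    exact: cvg_cst.
  exact: cvg_id.
have clL : closed L.
  apply: closedI => //; apply: (@preimage_closed _ _ _ [set t | l <= t]).
    by move=> y _; exact: cfx.
  exact: closed_ge.
have cL : compact L by exact: bounded_closed_compact.
have [y /set_mem[Yy ly] ymax] := EVT_max_rV L0 cL (continuous_subspaceT cfx).
exists y => // y' Yy'; have [ly'|/ltW y'l] := leP l (f (x, y')).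
  by apply: ymax; rewrite inE; split.
exact: le_trans y'l ly.
Qed.

(** * Global minimax points *)

Lemma global_minimax_of_attained (R : realType) (n m : nat)
    (X : set 'rV[R]_n) (Y : set 'rV[R]_m) (f : 'rV[R]_n * 'rV[R]_m -> R)
    (u : \bar R) :
  let Phi := [set x | X x /\ (maxval f Y x <= u)%E] in
  continuous f -> closed X -> Phi !=set0 -> bounded_set Phi ->
  (forall x, Phi x -> max_attained f Y x) ->
  exists xh yh, global_minimax X Y f xh yh.
Proof.
move=> Phi cf clX Phi0 bPhi att.
have cPhi : compact Phi.
  by apply: bounded_closed_compact => //; exact: closed_sublevel_maxval.
have [|x Phix xmin] :=
  @compact_closed_sublevel_min _ _ _ (maxval f Y) _ Phi0 cPhi.
  move=> c; apply: closed_sublevel_maxval => //.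
  exact: closed_sublevel_maxval.
have [Xx xu] := Phix; have [y Yy ymax] := att x Phix.
exists x, y; split => // x' y' Xx' Yy'; split; first exact: ymax.
rewrite -(maxval_attained Yy ymax).
have [x'u|/ltW ux'] := leP (maxval f Y x') u; first exact: xmin.
exact: le_trans xu ux'.
Qed.

(** * Radius functions from pointwise radii *)

(** The condition on [g] says that its hypograph is star-shaped with respect
    to the origin, so that [g t / t] is nonincreasing; together with the monotony of
    [g] this squeezes [g] near [x] between multiples of [g x]. *)
Lemma star_shaped_continuous (R : realType) (g : R -> R) :
  (forall s t, 0 < s -> s <= t -> g s <= g t) ->
  (forall a t, 0 <= a <= 1 -> 0 < t -> a * g t <= g (a * t)) ->
  {in `]0, +oo[, continuous g}.
Proof.
move=> g_mono g_star x; rewrite in_itv /= andbT => x0.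
have cdiv : y / x @[y --> x] --> x / x by apply: cvgMl; exact: cvg_id.
have c1 : (fun=> 1 : R) y @[y --> x] --> (1 : R) by exact: cvg_cst.
apply: (@squeeze_cvgr _ _ _ _ (fun y => Num.min 1 (y / x) * g x)
                              (fun y => Num.max 1 (y / x) * g x)).
- near=> y.
  have y0 : 0 < y by near: y; exact: lt_nbhsr.
  have [yx|/ltW xy] := leP y x.
    have yx1 : y / x <= 1 by rewrite ler_pdivrMr ?mul1r.
    rewrite (min_idPr _) // (max_idPl _) // mul1r g_mono // andbT.
    have := g_star (y / x) x; rewrite divfK ?gt_eqF //; apply => //.
    by rewrite yx1 andbT divr_ge0 // ltW.
  have yx1 : 1 <= y / x by rewrite ler_pdivlMr ?mul1r.
  rewrite (min_idPl _) // (max_idPr _) // mul1r g_mono //=.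
  rewrite mulrAC ler_pdivlMr // mulrC -ler_pdivrMl // mulrA [_^-1 * _]mulrC.
  have := g_star (x / y) y; rewrite divfK ?gt_eqF //; apply => //.
  by rewrite divr_ge0 ?ler_pdivrMr ?mul1r // ltW.
- suff : Num.min 1 (y / x) * g x @[y --> x] --> Num.min 1 (x / x) * g x.
    by rewrite divff ?gt_eqF // minxx mul1r.
  by apply: cvgMl; exact: (continuous_min c1 cdiv).
- suff : Num.max 1 (y / x) * g x @[y --> x] --> Num.max 1 (x / x) * g x.
    by rewrite divff ?gt_eqF // maxxx mul1r.
  by apply: cvgMl; exact: (continuous_max c1 cdiv).
Unshelve. all: by end_near.
Qed.

(** If the radius [rho s] serves the level [s], the task is to serve every
    small radius [d] by a level tending to 0 with [d], as a continuous function
    of [d]. The infimum over [0 < s <= e] of the affine functions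
    [d |-> s + e * d / rho s] is concave, hence continuous on the positive
    half-line, and each of these functions serves: at [d <= rho s] it is at
    least [s], and at [d > rho s] it exceeds the coarsest level [e]. Adding the
    term [d] makes the envelope exceed one of the affine functions even when
    the infimum is not attained. *)
Lemma radius_function_envelope (R : realType) (e : R) (rho : R -> R) :
  0 < e -> (forall s, 0 < s -> s <= e -> 0 < rho s) ->
  exists2 tau : R -> R, radius_function tau &
    forall d, 0 < d -> d <= rho e ->
      exists s, [/\ 0 < s, s <= e, d <= rho s & s <= tau d].
Proof.
move=> e0 rho0.
pose v d s := s + e * d / rho s.
pose V d := [set v d s | s in [set s | 0 < s <= e]].
pose tau d := d + inf (V d).
have ein : 0 < e <= e by rewrite e0 lexx.
have V0 d : V d !=set0 by exists (v d e), e.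
have slope_ge0 s : 0 < s <= e -> 0 <= e / rho s.
  by move=> /andP[s0 se]; rewrite divr_ge0 ?ltW // rho0.
have v_ge0 d s : 0 <= d -> 0 < s <= e -> 0 <= v d s.
  move=> d0 sin; rewrite addr_ge0 //; last by rewrite mulrAC mulr_ge0 ?slope_ge0.
  by case/andP: sin => /ltW.
have lbV d : 0 <= d -> lbound (V d) 0.
  by move=> d0 _ [s sin <-]; exact: v_ge0.
have infV_le d s : 0 <= d -> 0 < s <= e -> inf (V d) <= v d s.
  by move=> d0 sin; apply: ge_inf; [exists 0; exact: lbV | exists s].
have tau_ge0 d : 0 <= d -> 0 <= tau d.
  by move=> d0; rewrite addr_ge0 // lb_le_inf //; exact: lbV.
have tau_mono d1 d2 : 0 <= d1 -> d1 <= d2 -> tau d1 <= tau d2.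
  move=> d10 d12; apply: lerD => //; apply: lb_le_inf => // _ [s sin <-].
  apply: le_trans (infV_le d1 s d10 sin) _.
  by rewrite lerD2l ![e * _ / _]mulrAC ler_wpM2l ?slope_ge0.
have tau_star a d : 0 <= a <= 1 -> 0 < d -> a * tau d <= tau (a * d).
  move=> /andP[a0 a1] d0; rewrite mulrDr lerD2l.
  apply: lb_le_inf => // _ [s sin <-].
  apply: le_trans (ler_wpM2l a0 (infV_le d s (ltW d0) sin)) _.
  rewrite /v mulrDr lerD //; last by rewrite mulrA [a * (e * d)]mulrCA.
  by rewrite ler_piMl //; case/andP: sin => /ltW.
have tau0 : tau d @[d --> 0^'+] --> 0.
  apply/cvgrPdist_le => r r0.
  pose s := Num.min e (r / 3).
  have s0 : 0 < s by rewrite lt_min e0 divr_gt0.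
  have sin : 0 < s <= e by rewrite s0 ge_min lexx.
  have se : s <= e by rewrite ge_min lexx.
  near=> d.
  have d0 : 0 < d by near: d; exact: nbhs_right_gt.
  rewrite sub0r normrN (ger0_norm (tau_ge0 d (ltW d0))).
  apply: (@le_trans _ _ (d + v d s)); first by rewrite lerD2l infV_le // ltW.
  have dr : d <= r / 3 by near: d; apply: nbhs_right_le; rewrite divr_gt0.
  have sr : s <= r / 3 by rewrite ge_min lexx orbT.
  have vr : e * d / rho s <= r / 3.
    rewrite ler_pdivrMr ?rho0 // mulrC -ler_pdivlMr //.
    by near: d; apply: nbhs_right_le; rewrite divr_gt0 ?mulr_gt0 ?divr_gt0 ?rho0.
  rewrite /v; lra.
have tau00 : tau 0 = 0.
  apply/eqP; rewrite eq_le tau_ge0 // andbT /tau add0r; apply/ler_addgt0Pl => r r0.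
  have sin : 0 < Num.min e r <= e by rewrite lt_min e0 r0 ge_min lexx.
  apply: le_trans (infV_le _ _ (lexx 0) sin) _.
  by rewrite /v mulr0 mul0r !addr0 ge_min lexx orbT.
exists tau.
  split => //; apply/continuous_within_itvcyP; split; last by rewrite tau00.
  by apply: star_shaped_continuous => // s t /ltW; exact: tau_mono.
move=> d d0 drho; have infV : has_inf (V d).
  by split => //; exists 0; apply: lbV; exact: ltW.
have [_ [s sin <-]] := inf_adherent d0 infV; rewrite addrC => /ltW v_le.
have [s0 se] : 0 < s /\ s <= e by apply/andP.
have [ds|/ltW rho_d] := leP d (rho s).
  exists s; split => //; apply: le_trans v_le.
  by rewrite /v lerDl mulrAC mulr_ge0 ?slope_ge0 // ltW.
exists e; split => //; apply: le_trans v_le.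
apply: (@le_trans _ _ (e * d / rho s)); last by rewrite /v lerDr ltW.
by rewrite ler_pdivlMr ?rho0 // ler_wpM2l // ltW.
Unshelve. all: by end_near.
Qed.

(** * Local minimax points *)

Lemma eballS {R : realType} {n : nat} {A : set 'rV[R]_n} {a : 'rV[R]_n}
    {r s : R} :
  r <= s -> eball A a r `<=` eball A a s.
Proof. by move=> rs x [Ax xr]; split => //; exact: le_trans xr rs. Qed.

Lemma eball_center {R : realType} {n : nat} {A : set 'rV[R]_n}
    {a : 'rV[R]_n} {r : R} : A a -> 0 <= r -> eball A a r a.
Proof.
move=> Aa r0; split => //; rewrite subrr /enorm big1 ?sqrtr0 // => i _.
by rewrite mxE expr0n.
Qed.

Lemma local_minimax_maximizer (R : realType) (n m : nat)
    (X : set 'rV[R]_n) (Y : set 'rV[R]_m) (f : 'rV[R]_n * 'rV[R]_m -> R) xs ys :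
  local_minimax X Y f xs ys -> local_maximizer Y (fun y => f (xs, y)) ys.
Proof.
move=> [Xxs Yys [e [tau [e0 _ mm]]]]; split => //; exists e => // y yb.
by have [] := mm e e0 (lexx e) xs y (eball_center Xxs (ltW e0)) yb.
Qed.

(** On a ball where [ys] maximizes [f (xs, .)], the value of [phi_delta] at [xs]
    is [f (xs, ys)]; since [tau] tends to 0, the ball of radius [tau r] lies in
    that of radius [delta] once [r] is small. *)
Lemma local_minimax_minimizer (R : realType) (n m : nat)
    (X : set 'rV[R]_n) (Y : set 'rV[R]_m) (f : 'rV[R]_n * 'rV[R]_m -> R) xs ys :
  local_minimax X Y f xs ys ->
  exists2 e : R, 0 < e & forall d, 0 < d -> d <= e ->
    local_minimizer X (maxval f (eball Y ys d)) xs.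
Proof.
move=> [Xxs Yys [e [tau [e0 [_ _ _ tau0] mm]]]]; exists e => // d d0 de.
split => //.
have [r [r0 re taur]] : exists r, [/\ 0 < r, r <= e & tau r <= d].
  near (0 : R)^'+ => r; exists r; split; near: r.
  - exact: nbhs_right_gt.
  - exact: nbhs_right_le.
  - exact: cvgr_le tau0 _ d0.
exists r => // x xb.
have yb : eball Y ys r ys by apply: eball_center => //; exact: ltW.
rewrite (@maxval_attained _ _ _ _ _ _ ys); first last.
- move=> y yd; have xsb := eball_center Xxs (ltW e0).
  by have [] := mm e e0 (lexx e) xs y xsb (eballS de _ yd).
- by apply: eball_center => //; exact: ltW.
have [_ /le_trans] := mm r r0 re x ys xb yb; apply.
by apply: le_maxval; exact: eballS.
Unshelve. all: by end_near.
Qed.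

(** Choosing for each level [s] a radius [rho s] of local minimality of [phi_s]
    and taking the envelope of these radii gives the function [tau]. *)
Lemma local_minimax_of_minimizers (R : realType) (n m : nat)
    (X : set 'rV[R]_n) (Y : set 'rV[R]_m) (f : 'rV[R]_n * 'rV[R]_m -> R)
    xs ys (e : R) :
  local_maximizer Y (fun y => f (xs, y)) ys -> 0 < e ->
  (forall d, 0 < d -> d <= e ->
     local_minimizer X (maxval f (eball Y ys d)) xs) ->
  local_minimax X Y f xs ys.
Proof.
move=> [Yys [r r0 ymax]] e0 xmin.
have /choice[rho rhoP] (s : R) : exists t : R, 0 < s -> s <= e -> 0 < t /\
    forall x, eball X xs t x ->
      (maxval f (eball Y ys s) xs <= maxval f (eball Y ys s) x)%E.
  have [s0|s0] := ltP 0 s; last by exists 0.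
  have [se|se] := leP s e; last by exists 0.
  by have [_ [t t0 tP]] := xmin s s0 se; exists t.
have [Xxs _] := xmin e e0 (lexx e).
have [|tau rtau tauP] := @radius_function_envelope R e rho e0.
  by move=> s s0 se; have [] := rhoP s s0 se.
split => //; exists (Num.min r (rho e)), tau; split => //.
  by rewrite lt_min r0; have [] := rhoP e e0 (lexx e).
move=> d d0; rewrite le_min => /andP[dr drho] x y xb yb; split.
  by apply: ymax; exact: eballS yb.
have [s [s0 se drs stau]] := tauP d d0 drho.
have [_ /(_ x)] := rhoP s s0 se => /(_ (eballS drs _ xb)) le_s.
apply: (@le_trans _ _ (maxval f (eball Y ys s) xs)).
  by apply: ereal_sup_ubound; exists ys => //; apply: eball_center => //; exact: ltW.
by apply: le_trans le_s _; apply: le_maxval; exact: eballS.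
Qed.

Theorem proposition2p1 (R : realType) (n m : nat)
    (X : set 'rV[R]_n) (Y : set 'rV[R]_m) (f : 'rV[R]_n * 'rV[R]_m -> R)
    (X0 : X !=set0) (Xclosed : closed X) (Xconvex : convex_set X)
    (Y0 : Y !=set0) (Yclosed : closed Y) (Yconvex : convex_set Y)
    (flip : locally_lipschitz f)
    (phi_fin : forall x, X x -> maxval f Y x \is a fin_num) :
  let Phi (u : R) := [set x | X x /\ (maxval f Y x <= u%:E)%E] in
  let level x (l : R) := [set y | Y y /\ l <= f (x, y)] in
  (* (i), the max defining phi being attained at every point of X *)
  ((forall x, X x -> max_attained f Y x) ->
   forall u : R, Phi u !=set0 -> bounded_set (Phi u) ->
     (forall x, Phi u x -> exists l : R, bounded_set (level x l)) ->
     exists xh yh, global_minimax X Y f xh yh)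
  /\
  (* (i), phi being only a finite supremum: empty level sets are excluded *)
  (forall u : R, Phi u !=set0 -> bounded_set (Phi u) ->
     (forall x, Phi u x ->
        exists l : R, level x l !=set0 /\ bounded_set (level x l)) ->
     exists xh yh, global_minimax X Y f xh yh)
  /\
  (* (ii) *)
  (forall xs ys, X xs -> Y ys ->
     (local_minimax X Y f xs ys <->
      local_maximizer Y (fun y => f (xs, y)) ys /\
      exists2 delta0 : R, 0 < delta0 &
        forall delta, 0 < delta -> delta <= delta0 ->
          local_minimizer X (maxval f (eball Y ys delta)) xs)).
Proof.
have cf := locally_lipschitz_continuous R n m f flip.
move=> Phi level; split; [|split].
- move=> att u Phi0 bPhi _; apply: global_minimax_of_attained Phi0 bPhi _ => //.
  by move=> x [Xx _]; exact: att.
- move=> u Phi0 bPhi lev; apply: global_minimax_of_attained Phi0 bPhi _ => //.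
  by move=> x /lev[l [L0 bL]]; exact: max_attained_level L0 bL.
- move=> xs ys _ _; split=> [mm|[ymax [e e0 xmin]]].
    split; first exact: local_minimax_maximizer mm.
    exact: local_minimax_minimizer mm.
  exact: local_minimax_of_minimizers ymax e0 xmin.
Qed.
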